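(* Let $n\in\mathbb{Z}$. The two curves $f_n(x,y)=0$ and $\tau_n(x,y)=0$ in $\mathbb{R}^2$ have a common tangent line at every intersection point, while the second derivatives of their implicit functions at the intersection point do not coincide. In other words, every zero of $\tau_n(x,y)$ on the curve $f_n(x,y)=0$ has multiplicity two in the function ring $\mathbb{C}[x,y]/(f_n(x,y))$.
   Context: The Chebyshev polynomials $\mathcal{S}_m(z)\in\mathbb{Z}[z]$ ($m\in\mathbb{Z}$) are defined by $\mathcal{S}_0=0$, $\mathcal{S}_1=1$, $\mathcal{S}_{m+1}-z\mathcal{S}_m+\mathcal{S}_{m-1}=0$. Put $z=2x^2-x^2y+y^2-2$, so $z-2=-(y-2)(x^2-y-2)$. Define $$f_n(x,y)=(y-1)\mathcal{S}_n(z)-\mathcal{S}_{n-1}(z),\qquad \tau_n(x,y)=(2-x)\frac{\mathcal{S}_{n+1}(z)-\mathcal{S}_{n-1}(z)-2}{z-2}+x\,\mathcal{S}_n(z);$$ both lie in $\mathbb{Z}[x,y]$ (the fraction is a polynomial in $z$). Here $f_n(x,y)=0$ is the component of the $\mathrm{SL}_2(\mathbb{C})$-character variety of the twist knot $J(2,2n)$ containing the irreducible characters, and $\tau_n$ is the Reidemeister torsion function. The implicit functions at an intersection point are the functions $y=y_f(x)$, $y=y_\tau(x)$ locally defined by $f_n(x,y)=0$ and $\tau_n(x,y)=0$ respectively when the partial derivatives with respect to $y$ are nonzero at the point, or $x=x_f(y)$, $x=x_\tau(y)$ when the partial derivatives with respect to $x$ are nonzero at the point; the statement compares $y_f$ with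 $y_\tau$, or $x_f$ with $x_\tau$. A common zero $(a,b)\in\mathbb{C}^2$ of $f_n$ and $\tau_n$ has multiplicity $m$ if the class of $\tau_n$ in $\mathbb{C}[x,y]/(f_n)$ lies in $(x-a,y-b)^m$ but not in $(x-a,y-b)^{m+1}$. *)

(* Defs.v *)
From HB Require Import structures.
From mathcomp Require Import all_boot all_order all_algebra.
From mathcomp Require Import complex.
From mathcomp Require Import all_classical all_reals all_analysis.
From mathcomp Require Import ring.
Import Order.TTheory GRing.Theory Num.Theory.
Import numFieldNormedType.Exports.

Set Implicit Arguments.
Unset Strict Implicit.
Unset Printing Implicit Defensive.

Local Open Scope classical_set_scope.
Local Open Scope ring_scope.

(* cheb_pair m = (S_m, S_{m+1}); the recurrence is run backwards for m < 0. *)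
Definition cheb_pair (m : int) : {poly int} * {poly int} :=
  match m with
  | Posz k => iter k (fun s => (s.2, 'X * s.2 - s.1)) (0, 1)
  | Negz k => iter k.+1 (fun s => ('X * s.1 - s.2, s.1)) (0, 1)
  end.

Definition chebS (m : int) : {poly int} := (cheb_pair m).1.

Lemma cheb_pairS (m : int) :
  cheb_pair (m + 1) = ((cheb_pair m).2, 'X * (cheb_pair m).2 - (cheb_pair m).1).
Proof.
case: m => [k|k]; first by rewrite -PoszD addn1.
have -> : Negz k + 1 = - k%:Z by rewrite NegzE -addn1 PoszD opprD addrNK.
case: k => [|k]; first by rewrite /= mulr0 !sub0r opprK.
rewrite -NegzE /=; case: (iter _ _ _) => a b /=.
by rewrite subKr.
Qed.

Lemma chebS0 : chebS 0 = 0. Proof. by []. Qed.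
Lemma chebS1 : chebS 1 = 1. Proof. by []. Qed.

Lemma chebS_rec (m : int) : chebS (m + 1) - 'X * chebS m + chebS (m - 1) = 0.
Proof.
have := cheb_pairS (m - 1); have := cheb_pairS m; rewrite subrK /chebS => -> ->.
by rewrite /=; ring.
Qed.

Lemma cheb_pair2 (m : int) :
  (cheb_pair m).1.[2] = m /\ (cheb_pair m).2.[2] = m + 1.
Proof.
elim/int_rect: m => [|k IH|k IH]; first by rewrite /= !hornerE.
- have -> : k.+1%:Z = k%:Z + 1 by rewrite -addn1.
  by case: IH; rewrite cheb_pairS /= !hornerE => -> ->; split=> //; ring.
- have Ek : - k%:Z = - k.+1%:Z + 1 by rewrite -addn1 PoszD; ring.
  case: IH; rewrite Ek cheb_pairS /= !hornerE => h1.
  rewrite h1 => h2; split=> //.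
  by rewrite -[LHS](subKr (2 * (- k.+1%:Z + 1))) h2; ring.
Qed.

(* The division is exact; see torsion_quotK. *)
Definition torsion_quot (n : int) : {poly int} :=
  (chebS (n + 1) - chebS (n - 1) - 2%:P) %/ ('X - 2%:P).

Lemma torsion_quotK (n : int) :
  torsion_quot n * ('X - 2%:P) = chebS (n + 1) - chebS (n - 1) - 2%:P.
Proof.
apply: Pdiv.IdomainUnit.divpK; first by rewrite lead_coefXsubC unitr1.
rewrite dvdp_XsubCl rootE !hornerE /chebS.
have [-> _] := cheb_pair2 (n + 1); have [-> _] := cheb_pair2 (n - 1).
by apply/eqP; ring.
Qed.

Definition zXY : {poly {poly int}} :=
  2 * 'X ^+ 2 - 'X ^+ 2 * 'Y + 'Y ^+ 2 - 2.

Definition at_z (p : {poly int}) : {poly {poly int}} := (map_poly intr p).[zXY].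

Definition f_ (n : int) : {poly {poly int}} :=
  ('Y - 1) * at_z (chebS n) - at_z (chebS (n - 1)).

Definition tau_ (n : int) : {poly {poly int}} :=
  (2 - 'X) * at_z (torsion_quot n) + 'X * at_z (chebS n).

Definition extXY (K : nzRingType) (p : {poly {poly int}}) : {poly {poly K}} :=
  map_poly (map_poly intr) p.

Section Ideals.
Variable A : comNzRingType.

Definition ideal_gen (s : seq A) : set A :=
  [set p | exists c : 'I_(size s) -> A, p = \sum_(i < size s) c i * s`_i].

Definition ideal_mul (I J : set A) : set A :=
  [set p | exists2 s : seq (A * A),
     (forall u, u \in s -> I u.1 /\ J u.2) & p = \sum_(u <- s) u.1 * u.2].

Definition ideal_pow (I : set A) (m : nat) : set A := iter m (ideal_mul I) setT.

(* The class of p in A/(f) lies in the image of I, i.e. p is congruent modulo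
   (f) to an element of I. *)
Definition class_in_ideal (f : A) (I : set A) (p : A) : Prop :=
  exists2 q, I q & ideal_gen [:: f] (p - q).

End Ideals.

Definition point_ideal (K : comNzRingType) (a b : K) : set {poly {poly K}} :=
  ideal_gen [:: 'X - a%:P%:P; 'Y - b%:P%:P].

Definition zero_multiplicity (K : comNzRingType) (f g : {poly {poly K}})
    (a b : K) (m : nat) : Prop :=
  class_in_ideal f (ideal_pow (point_ideal a b) m) g /\
  ~ class_in_ideal f (ideal_pow (point_ideal a b) m.+1) g.

Section RealCurves.
Variable R : realType.
Implicit Types (F G : R -> R -> R) (a b : R) (g h : R -> R).

Definition partial_x F a b : R := ((fun x => F x b)^`() a)%classic.
Definition partial_y F a b : R := ((fun y => F a y)^`() b)%classic.

Definition is_tangent_line F a b (L : set (R * R)) : Prop :=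
  ((partial_x F a b != 0) || (partial_y F a b != 0)) /\
  L = [set p | partial_x F a b * (p.1 - a) + partial_y F a b * (p.2 - b) = 0].

Definition common_tangent_line F G a b : Prop :=
  exists L : set (R * R), is_tangent_line F a b L /\ is_tangent_line G a b L.

Definition implicit_function F a b g : Prop :=
  [/\ g a = b, {for a, continuous g} &
      \forall p \near ((a, b) : R * R), F p.1 p.2 = 0 <-> p.2 = g p.1].

Lemma implicit_function_unique F a b g h :
  implicit_function F a b g -> implicit_function F a b h ->
  \forall x \near a, g x = h x.
Proof.
move=> [ga cg Fg] [ha ch Fh].
have graph k : k a = b -> {for a, continuous k} ->
    (x, k x) @[x --> a] --> ((a, b) : R * R).
  by move=> <- ck; exact: (@cvg_pair _ _ _ (nbhs a) (nbhs a) (nbhs (k a))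
      _ _ _ id k (@cvg_id _ _) ck).
have H1 : \forall x \near a, F x (g x) = 0 <-> g x = g x := graph _ ga cg _ Fg.
have H2 : \forall x \near a, F x (g x) = 0 <-> g x = h x := graph _ ga cg _ Fh.
by near=> x; apply/(near H2 x _)/(near H1 x _).
Unshelve. all: by end_near. Qed.

Definition twice_derivable g a : Prop :=
  (\forall x \near a, derivable g x 1) /\ derivable (g^`())%classic a 1.

(* Since germs of implicit functions are unique (implicit_function_unique), it
   is immaterial whether g and h are quantified existentially or universally;
   the existential form also asserts that they exist. *)
Definition implicit_second_derivatives_differ F G a b : Prop :=
  exists g h,
    [/\ implicit_function F a b g, implicit_function G a b h,
        twice_derivable g a, twice_derivable h a &
        ((g^`(2) a)%classic != (h^`(2) a)%classic)].

End RealCurves.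

(* Main.v *)
Require Import Defs.
From HB Require Import structures.
From mathcomp Require Import all_boot all_order all_algebra.
From mathcomp Require Import complex polyrcf.
From mathcomp Require Import all_classical all_reals all_analysis.
From mathcomp Require Import ring lra zify.
Import Order.TTheory GRing.Theory Num.Theory.
Import numFieldNormedType.Exports.

Set Implicit Arguments.
Unset Strict Implicit.
Unset Printing Implicit Defensive.

Local Open Scope ring_scope.

(* Put z = t + 1/t, S = S_n(z), P = S_(n-1)(z), so that S^2 + P^2 - z S P = 1.
On the curve f = 0 one has y - 1 = P / S, and x^2 becomes a rational function of
t and w = t^n; so does its value on tau = 0, and the difference of the two is a
unit times (w^3 - t)^2. Hence, near a common zero, up to units and modulo f, tau
is the square of h = S_(3n-1)(z), whose zeros with t^(3n-1) = 1 are simple. At a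
common zero t <> 1, -1, and z restricts to a local parameter on f = 0; therefore
h vanishes there to order one and tau to order two. Concretely
k tau = c h^2 + g f with k, c and g nonzero at the point: the gradients of f and
tau are proportional, and the second derivatives along the common tangent differ
by a multiple of (dh)^2. *)

(** * Identities for consecutive Chebyshev polynomials and the torsion quotient *)

Lemma chebS_succ n : chebS (n + 1) = 'X * chebS n - chebS (n - 1).
Proof.
by apply/eqP; rewrite -subr_eq0; apply/eqP; rewrite -[RHS](chebS_rec n); ring.
Qed.

(** The predicate ranges over abstract values of two consecutive polynomials, so that each step of
    the two-sided induction becomes a ring identity. *)
Lemma cheb_ind (Pr : {poly int} -> {poly int} -> int -> Prop) :
  Pr 0 (-1) 0 ->
  (forall s p n, Pr s p n -> Pr ('X * s - p) s (n + 1)) ->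
  (forall s p n, Pr s p n -> Pr p ('X * p - s) (n - 1)) ->
  forall n, Pr (chebS n) (chebS (n - 1)) n.
Proof.
move=> Pr0 PrS PrP.
elim/int_rect => [|k IH|k IH].
- have := chebS_succ 0; rewrite add0r sub0r chebS0 chebS1 mulr0 sub0r => E.
  by rewrite -[chebS (-1)]opprK -E.
- have -> : k.+1%:Z = k%:Z + 1 by rewrite -addn1.
  by rewrite addrK chebS_succ; exact: PrS.
- have -> : - k.+1%:Z = - k%:Z - 1 by rewrite -addn1 PoszD; ring.
  have E := chebS_succ (- k%:Z - 1); rewrite subrK in E.
  have -> : chebS (- k%:Z - 1 - 1) = 'X * chebS (- k%:Z - 1) - chebS (- k%:Z).
    by rewrite E; ring.
  exact: PrP.
Qed.

(** The form [s^2 - X s p + p^2] is invariant under the step [(s, p) -> (X s - p, s)] and equals 1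
    at [(0, -1)]. *)
Lemma chebS_quad n :
  chebS (n - 1) ^+ 2 = 1 + 'X * chebS n * chebS (n - 1) - chebS n ^+ 2.
Proof.
move: n; apply: (cheb_ind (Pr := fun s p _ => p ^+ 2 = 1 + 'X * s * p - s ^+ 2)).
- ring.
- by move=> s p _ IH; ring: IH.
- by move=> s p _ IH; ring: IH.
Qed.

(** For [z = t + 1/t] this is [S_n = (t^n - t^-n) / (t - 1/t)] differentiated in [z], with
    [z S_n - 2 S_(n-1) = t^n + t^-n]. The two formulas are proved together because each induction
    step mixes them. *)
Lemma chebS_deriv n :
  ('X ^+ 2 - 4) * (chebS n)^`() =
    n%:~R * ('X * chebS n - 2 * chebS (n - 1)) - 'X * chebS n /\
  ('X ^+ 2 - 4) * (chebS (n - 1))^`() =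
    (n%:~R - 1) * (2 * chebS n - 'X * chebS (n - 1)) - 'X * chebS (n - 1).
Proof.
move: n; apply: (cheb_ind (Pr := fun s p n =>
  ('X ^+ 2 - 4) * s^`() = n%:~R * ('X * s - 2 * p) - 'X * s /\
  ('X ^+ 2 - 4) * p^`() = (n%:~R - 1) * (2 * s - 'X * p) - 'X * p));
  [|move=> s p n [IHs IHp]|move=> s p n [IHs IHp]].
- by rewrite derivN deriv0 -[1]/(1%:P) derivC; split; ring.
- rewrite derivB derivM derivX rmorphD /=; split; last by rewrite IHs; ring.
  by rewrite mulrBr mul1r mulrDr mulrCA IHs IHp; ring.
- rewrite derivB derivM derivX rmorphB /=; split; first by rewrite IHp; ring.
  by rewrite mulrBr mul1r mulrDr mulrCA IHs IHp; ring.
Qed.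

Lemma torsion_quotX n :
  torsion_quot n * ('X - 2) = 'X * chebS n - 2 * chebS (n - 1) - 2.
Proof.
have c2 : 2%:P = 2 :> {poly int} by rewrite rmorph_nat.
by rewrite -[in LHS]c2 torsion_quotK chebS_succ c2; ring.
Qed.

(** With [q] the quotient, [q (z - 2)] is [t^n + t^-n - 2]; its product with [t^n + t^-n + 2] is
    [(t^n - t^-n)^2 = (z^2 - 4) S_n^2], and [z - 2] cancels. Unlike [torsion_quotX], this still
    determines [q] at [z = 2]. *)
Lemma torsion_quot_quad n :
  torsion_quot n * (torsion_quot n * ('X - 2) + 4) = ('X + 2) * chebS n ^+ 2.
Proof.
have z2 : 'X - 2 != 0 :> {poly int} by rewrite -(rmorph_nat polyC 2) polyXsubC_eq0.
apply: (mulIf z2); have E := chebS_quad n; have Q := torsion_quotX n.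
by rewrite mulrAC Q; ring: E Q.
Qed.

(** * Directional derivatives of bivariate polynomials and contact of plane curves *)

Definition dX (K : numFieldType) (u : {poly {poly K}}) : {poly {poly K}} := u^`().

Definition dY (K : numFieldType) (u : {poly {poly K}}) : {poly {poly K}} :=
  swapXY (swapXY u)^`().

(* Locked, lest rewriting with [dirM] or [dirD] look inside nested derivatives. *)
HB.lock Definition dir (K : numFieldType) (α β : K) (u : {poly {poly K}}) :
    {poly {poly K}} :=
  α%:P%:P * dX u + β%:P%:P * dY u.

Section Bivariate.
Variable K : numFieldType.
Local Notation A := {poly {poly K}}.
Implicit Types (u v w k c g : A) (a b α β : K).

Lemma horner2D u v a b : (u + v).[a, b] = u.[a, b] + v.[a, b].
Proof. by rewrite !hornerD. Qed.

Lemma horner2M u v a b : (u * v).[a, b] = u.[a, b] * v.[a, b].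
Proof. by rewrite !hornerM. Qed.

Lemma dir_is_zmod_morphism α β : zmod_morphism (dir α β).
Proof. by move=> u v; rewrite dir.unlock /dX /dY !raddfB /=; ring. Qed.
HB.instance Definition _ α β :=
  GRing.isZmodMorphism.Build A A (dir α β) (dir_is_zmod_morphism α β).

Lemma dirD α β u v : dir α β (u + v) = dir α β u + dir α β v.
Proof. exact: raddfD. Qed.

Lemma dirB α β u v : dir α β (u - v) = dir α β u - dir α β v.
Proof. exact: raddfB. Qed.

Lemma dirM α β u v : dir α β (u * v) = dir α β u * v + u * dir α β v.
Proof.
by rewrite dir.unlock /dX /dY rmorphM !derivM rmorphD !rmorphM /= !swapXYK; ring.
Qed.

Lemma dirXn α β u (m : nat) :
  dir α β (u ^+ m.+1) = m.+1%:R * u ^+ m * dir α β u.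
Proof.
elim: m => [|m IH]; first by rewrite expr1 expr0 !mul1r.
by rewrite exprS dirM IH exprS -[m.+2]addn1 natrD; ring.
Qed.

Lemma dir_int α β (m : int) : dir α β m%:~R = 0.
Proof.
suff D1 : dir α β 1 = 0 by rewrite raddfMz /= D1 mul0rz.
by apply: (addrI (dir α β 1)); rewrite -{3}[1]mulr1 dirM !mulr1 mul1r addr0.
Qed.

Lemma dir_nat α β (m : nat) : dir α β m%:R = 0.
Proof. exact: (dir_int α β m). Qed.

Lemma dir_X α β : dir α β 'X = α%:P%:P.
Proof. by rewrite dir.unlock /dX /dY swapXY_X derivX derivC raddf0; ring. Qed.

Lemma dir_Y α β : dir α β 'Y = β%:P%:P.
Proof. by rewrite dir.unlock /dX /dY swapXY_Y derivX derivC rmorph1; ring. Qed.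

Lemma dir_C α β (c : K) : dir α β c%:P%:P = 0.
Proof.
by rewrite dir.unlock /dX /dY swapXY_polyC map_polyC /= !derivC raddf0 !mulr0 addr0.
Qed.

Lemma dir_comp α β (s : {poly int}) u :
  dir α β (map_poly intr s).[u] = (map_poly intr s^`()).[u] * dir α β u.
Proof.
elim/poly_ind: s => [|s c IH].
  by rewrite deriv0 !rmorph0 !horner0 raddf0 mul0r.
rewrite derivD derivM derivX mulr1 derivC addr0 !rmorphD !rmorphM /=.
by rewrite map_polyX map_polyC /= !hornerE dirD dirM IH dir_int; ring.
Qed.

Lemma dir_swap α β u : dir α β (swapXY u) = swapXY (dir β α u).
Proof.
rewrite dir.unlock /dX /dY rmorphD !rmorphM /= !swapXY_polyC !map_polyC /=.
by rewrite !swapXYK addrC.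
Qed.

Lemma horner2_dir α β u a b :
  (dir α β u).[a, b] = α * (dX u).[a, b] + β * (dY u).[a, b].
Proof. by rewrite dir.unlock !hornerE. Qed.

(* [u] and [v] touch to order exactly two at [(a, b)]: the 2-jet of [v - r u]
   vanishes to first order and is nonzero on the tangent direction of [u]. *)
Record simple_contact u v a b : Prop := SimpleContact {
  contact_zero1 : u.[a, b] = 0;
  contact_zero2 : v.[a, b] = 0;
  contact_grad : ((dX u).[a, b] != 0) || ((dY u).[a, b] != 0);
  contact_dir : exists2 r : K, r != 0 &
    (forall α β, (dir α β v).[a, b] = r * (dir α β u).[a, b]) /\
    (forall α β, (α != 0) || (β != 0) -> (dir α β u).[a, b] = 0 ->
      (dir α β (dir α β v)).[a, b] != r * (dir α β (dir α β u)).[a, b])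
}.

(** Reduces the implicit functions [x(y)] to the case of [y(x)]. *)
Lemma simple_contact_swap u v a b :
  simple_contact u v a b -> simple_contact (swapXY u) (swapXY v) b a.
Proof.
have dXs w : dX (swapXY w) = swapXY (dY w) by rewrite /dX /dY swapXYK.
have dYs w : dY (swapXY w) = swapXY (dX w) by rewrite /dX /dY swapXYK.
case=> u0 v0 gr [g g0 [d1 d2]]; split; [by rewrite horner2_swapXY..| |].
  by rewrite dXs dYs (horner2_swapXY (dX u)) (horner2_swapXY (dY u)) orbC.
exists g => //.
split=> [α β|α β n0]; rewrite !dir_swap !(horner2_swapXY (dir _ _ _)) //.
by apply: d2; rewrite orbC.
Qed.

(** Differentiate the relation at the point. To first order [w^2] contributes nothing, so
    [r = g / k]; to second order along the tangent of [u], it contributes [2 c (Dw)^2], which is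
    nonzero. *)
Lemma simple_contactI u v w k c g a b :
    u.[a, b] = 0 -> v.[a, b] = 0 -> w.[a, b] = 0 ->
    k * v = c * w ^+ 2 + g * u ->
    k.[a, b] != 0 -> c.[a, b] != 0 -> g.[a, b] != 0 ->
    ((dX u).[a, b] != 0) || ((dY u).[a, b] != 0) ->
    (forall α β, (α != 0) || (β != 0) -> (dir α β u).[a, b] = 0 ->
      (dir α β w).[a, b] != 0) ->
  simple_contact u v a b.
Proof.
move=> u0 v0 w0 E k0 c0 g0 gr tr.
have d1 α β : (dir α β v).[a, b] = g.[a, b] / k.[a, b] * (dir α β u).[a, b].
  have := congr1 (fun p => (dir α β p).[a, b]) E.
  rewrite expr2 !(dirD, dirM) !(horner2D, horner2M) v0 u0 w0 => E1.
  apply: (mulfI k0); rewrite [RHS]mulrA [k.[a, b] * (_ / _)]mulrC divfK //.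
  by move: E1; rewrite !(mulr0, mul0r, addr0, add0r).
split=> //; exists (g.[a, b] / k.[a, b]); first by rewrite mulf_neq0 // invr_neq0.
split=> // α β n0 t0; apply: contraNneq (tr _ _ n0 t0) => d2.
have Dv0 : (dir α β v).[a, b] = 0 by rewrite d1 t0 mulr0.
have := congr1 (fun p => (dir α β (dir α β p)).[a, b]) E.
rewrite expr2 !(dirD, dirM).
rewrite !(horner2D, horner2M) v0 u0 w0 t0 Dv0 d2.
rewrite !(mulr0, mul0r, addr0, add0r).
set D := (dir α β w).[a, b]; set D2 := (dir α β (dir α β u)).[a, b] => E2.
have : c.[a, b] * D ^+ 2 *+ 2 = 0.
  transitivity (k.[a, b] * (g.[a, b] / k.[a, b] * D2) - g.[a, b] * D2).
    by rewrite E2; ring.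
  by field.
by move/eqP; rewrite mulrn_eq0 mulf_eq0 expf_eq0 (negPf c0).
Qed.

Lemma dY_C (c : {poly K}) : dY c%:P = c^`()%:P.
Proof. by rewrite /dY swapXY_polyC deriv_map swapXY_map_polyC. Qed.

Lemma dirE α β u : dir α β u = α%:P%:P * dX u + β%:P%:P * dY u.
Proof. by rewrite dir.unlock. Qed.

Lemma dXMXaddC (p : A) (c : {poly K}) : dX (p * 'X + c%:P) = dX p * 'X + p.
Proof. by rewrite /dX derivD derivC derivM derivX mulr1 addr0. Qed.

Lemma dYMXaddC (p : A) (c : {poly K}) : dY (p * 'X + c%:P) = dY p * 'X + c^`()%:P.
Proof.
rewrite -dY_C /dY !raddfD /= rmorphM /= swapXY_X derivM derivC mulr0 addr0.
by rewrite rmorphM /= swapXY_Y.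
Qed.

Lemma horner_dY (p : A) (x : K) : (dY p).[x%:P] = p.[x%:P]^`().
Proof.
elim/poly_ind: p => [|p c IH]; first by rewrite /dY !raddf0 !horner0 raddf0.
by rewrite dYMXaddC !hornerMXaddC IH derivD derivM derivC mulr0 addr0.
Qed.

End Bivariate.

(** * Algebraic relations between the twist knot curve and its torsion *)

Section TwistIdentities.
Variable R : comNzRingType.
Implicit Types x y z s p q : R.

(* With [z = t + 1/t], [s = S_n(z)] and [p = S_(n-1)(z)], these are
   [S_(3n-1)(z)] and [t ^ (3n-1) + t ^ (1-3n) = S_(3n)(z) - S_(3n-2)(z)]. *)
Definition cheb3 z s p : R := z * s ^+ 3 - 3 * s ^+ 2 * p + p ^+ 3.

Definition lucas3 z s p : R :=
  s * (z * s - 2 * p) * (z * s - p) - (s ^+ 2 - p ^+ 2) * s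
  - (s * (z * s - 2 * p) * p - (s ^+ 2 - p ^+ 2) * (z * p - s)).

(** This is [(T + 1/T)^2 - 4 = (T - 1/T)^2] for [T = t^(3n-1)]. *)
Lemma lucas3_quad z s p : p ^+ 2 = 1 + z * s * p - s ^+ 2 ->
  lucas3 z s p ^+ 2 - 4 = (z ^+ 2 - 4) * cheb3 z s p ^+ 2.
Proof. by move=> E; rewrite /lucas3 /cheb3; ring: E. Qed.

(** Put [t0 = z s - 2 p - 2] and [d = s - p - 1]. On [f = 0] the bracket equals
    [s (s - p) (t0^2 - x^2 d^2)] by [twist_x2], so a common zero of the curves makes the right side
    vanish. *)
Lemma lucas3_fact z s p : p ^+ 2 = 1 + z * s * p - s ^+ 2 ->
  (z + 2) * (s * (s - p) * (z * s - 2 * p - 2) ^+ 2 -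
    (s - p - 1) ^+ 2 * ((z + 2) * s * (s - p) - 1)) =
  (lucas3 z s p - 2) * (z * s - 2 * p - 2).
Proof. by move=> E; rewrite /lucas3; ring: E. Qed.

(** Multiply [x^2 (2 - y) = z + 2 - y^2] by [s^2] and substitute [y s = s + p + f], where
    [f = (y - 1) s - p]; the quadratic relation gives [(s + p)^2 = 1 + (z + 2) s p]. *)
Lemma twist_x2 x y z s p : z = 2 * x ^+ 2 - x ^+ 2 * y + y ^+ 2 - 2 ->
  p ^+ 2 = 1 + z * s * p - s ^+ 2 ->
  x ^+ 2 * s * (s - p) = (z + 2) * s * (s - p) - 1 +
    ((y - 1) * s - p) * (x ^+ 2 * s - 2 * y * s + ((y - 1) * s - p)).
Proof. by move=> -> E; ring: E. Qed.

Lemma twist_torsion x z s p q : q * (z - 2) = z * s - 2 * p - 2 ->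
  (z - 2) * ((2 - x) * q + x * s) = 2 * (z * s - 2 * p - 2 - x * (s - p - 1)).
Proof.
move=> E; transitivity ((2 - x) * (q * (z - 2)) + x * s * (z - 2)); first by ring.
by rewrite E; ring.
Qed.

(* The product of [t0 - x d] (the torsion up to units) with [t0 + x d] is
   [t0 ^ 2 - x ^ 2 d ^ 2], in which [twist_x2] eliminates [x ^ 2]. *)
Lemma twist_contact_eq x y z s p q :
  z = 2 * x ^+ 2 - x ^+ 2 * y + y ^+ 2 - 2 ->
  p ^+ 2 = 1 + z * s * p - s ^+ 2 -> q * (z - 2) = z * s - 2 * p - 2 ->
  let f := (y - 1) * s - p in let l := lucas3 z s p in
  let t0 := z * s - 2 * p - 2 in let d := s - p - 1 in
  (z + 2) * (l + 2) * s * (s - p) * (z - 2) * (t0 + x * d) *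
      ((2 - x) * q + x * s) =
    2 * t0 * (z ^+ 2 - 4) * cheb3 z s p ^+ 2 +
    (- 2 * (x ^+ 2 * s - 2 * y * s + f) * d ^+ 2 * (z + 2) * (l + 2)) * f.
Proof.
move=> Ez E Eq f l t0 d; set g := x ^+ 2 * s - _ + f.
transitivity ((z + 2) * (l + 2) * s * (s - p) * (t0 + x * d) *
    ((z - 2) * ((2 - x) * q + x * s))); first by ring.
rewrite (twist_torsion _ Eq) -/t0 -/d.
transitivity (2 * t0 * (l ^+ 2 - 4) -
    2 * (l + 2) * (z + 2) * d ^+ 2 * (f * g)); last first.
  by rewrite lucas3_quad //; ring.
transitivity (2 * (l + 2) * ((l - 2) * t0) -
    2 * (l + 2) * (z + 2) * d ^+ 2 * (f * g)); last by ring.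
rewrite -lucas3_fact // -/t0 -/d.
have -> : f * g = x ^+ 2 * s * (s - p) - ((z + 2) * s * (s - p) - 1).
  by rewrite (twist_x2 Ez E) -/f -/g; ring.
by ring.
Qed.

End TwistIdentities.

(* Here [c] stands for [n] and [q] for the torsion quotient. At [z = 2] and at
   [z = - 2] the equations force [(3 c - 1) ^ 2 = 0]; elsewhere they give
   [lucas3 = 2], i.e. [t ^ (3n-1) = 1]. The last inequality is what makes the
   torsion curve smooth at the common zero. *)
Lemma twist_common_zero (K : numFieldType) (c x y z s p q : K) :
    3 * c != 1 -> z = 2 * x ^+ 2 - x ^+ 2 * y + y ^+ 2 - 2 ->
    p ^+ 2 = 1 + z * s * p - s ^+ 2 ->
    q * (z - 2) = z * s - 2 * p - 2 ->
    q * (q * (z - 2) + 4) = (z + 2) * s ^+ 2 ->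
    (z = 2 -> s = c /\ p = c - 1) -> (z = - 2 -> s = c * (s + p)) ->
    (y - 1) * s - p = 0 -> (2 - x) * q + x * s = 0 ->
  [/\ [/\ s != 0, z - 2 != 0, z + 2 != 0 & z * s - 2 * p - 2 != 0],
      [/\ x != 0, y - 2 != 0, s - p != 0 & s - p - 1 != 0],
      z * s - 2 * p - 2 = x * (s - p - 1) &
      [/\ lucas3 z s p = 2, cheb3 z s p = 0 & x ^+ 2 * s - 2 * y * s != 0]].
Proof.
move=> c3 Ez Eq Equ Equq z2 zm2 F0 T0.
have Ex := twist_x2 Ez Eq; rewrite F0 mul0r addr0 in Ex.
have El := lucas3_fact Eq; have Eh := lucas3_quad Eq.
set l := lucas3 z s p in El Eh *; set h := cheb3 z s p in Eh *.
have Ehd : h = z * s ^+ 3 - 3 * s ^+ 2 * p + p ^+ 3 by [].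
have n0 : 1 != 0 :> K by exact: oner_neq0.
have sq0 (u : K) : u ^+ 2 = 0 -> u = 0 by move/eqP; rewrite expf_eq0 => /eqP.
have lc (u v w : K) : w = 0 -> u - v = w -> u = v.
  by move=> -> /eqP; rewrite subr_eq0 => /eqP.
have c31 : 3 * c - 1 != 0 by rewrite subr_eq0.
have Ep : p = (y - 1) * s by apply/eqP; rewrite eq_sym -subr_eq0 F0.
have s0 : s != 0.
  apply: contra_neq n0 => s0; move: Eq; rewrite Ep s0.
  by rewrite !(mulr0, expr0n, subr0, addr0) /= => /esym.
have zn2 : z - 2 != 0.
  apply: contra_neq c31 => /eqP; rewrite subr_eq0 => /eqP zE; have [sE pE] := z2 zE.
  (* The linear relation for [q] is void at [z = 2]; the quadratic one gives its value. *)
  have qE : q = c ^+ 2.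
    apply: (@mulIf _ 4); first by rewrite pnatr_eq0.
    by move: Equq; rewrite zE subrr mulr0 add0r sE => ->; ring.
  have yc : y * c = 2 * c - 1 by move: F0; rewrite sE pE => /lc; apply; ring.
  have c0 : c != 0 by rewrite -sE.
  have xc : x ^+ 2 * c = 4 * c - 1.
    have H : z - (2 * x ^+ 2 - x ^+ 2 * y + y ^+ 2 - 2) = 0 by rewrite {1}Ez subrr.
    apply: (lc _ _ (- c ^+ 2 * (z - (2 * x ^+ 2 - x ^+ 2 * y + y ^+ 2 - 2)))).
      by rewrite H mulr0.
    by rewrite zE; ring: yc.
  have xc1 : x * (c - 1) = 2 * c.
    apply: (mulIf c0); apply: (lc _ _ (- ((2 - x) * q + x * s))).
      by rewrite T0 oppr0.
    by rewrite qE sE; ring.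
  (* Squaring [x (c - 1) = 2 c] and inserting [x^2 c = 4 c - 1] eliminates [x]. *)
  apply: sq0.
  have -> : (3 * c - 1) ^+ 2 = 4 * c ^+ 3 - (4 * c - 1) * (c - 1) ^+ 2 by ring.
  rewrite -xc; have -> : 4 * c ^+ 3 = (2 * c) ^+ 2 * c by ring.
  by rewrite -xc1; ring.
have zp2 : z + 2 != 0.
  apply: contra_neq c31 => zE'; have zE : z = - 2 by apply: (lc _ _ _ zE'); ring.
  (* For the Chebyshev values [e] is the sign [(-1)^(n-1)]. If [e = -1], then [q = 0] and the
     torsion reduces to [x s], which is nonzero; so [e = 1]. *)
  set e := s + p; have sE : s = c * e := zm2 zE.
  have e2 : e ^+ 2 = 1.
    by apply: (lc _ _ (p ^+ 2 - (1 + z * s * p - s ^+ 2)));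
      [rewrite Eq subrr | rewrite zE /e; ring].
  have ys : y * s = e by apply: (lc _ _ _ F0); rewrite /e; ring.
  have qe : 2 * q = 1 + e.
    apply: (@mulIf _ (- 2)); first by rewrite oppr_eq0 pnatr_eq0.
    apply: (lc _ _ (q * (z - 2) - (z * s - 2 * p - 2))); first by rewrite Equ subrr.
    by rewrite zE /e; ring.
  have xc : x ^+ 2 * (2 * c ^+ 2 - c) = - 1.
    have H : z - (2 * x ^+ 2 - x ^+ 2 * y + y ^+ 2 - 2) = 0 by rewrite {1}Ez subrr.
    have ys2 : y ^+ 2 * s ^+ 2 = 1 by rewrite -exprMn ys.
    have xs : x ^+ 2 * y * s ^+ 2 = x ^+ 2 * c.
      transitivity (x ^+ 2 * (y * s) * s); first by ring.
      by rewrite ys {1}sE; ring: e2.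
    have s2 : s ^+ 2 = c ^+ 2 by rewrite sE exprMn e2 mulr1.
    apply: (lc _ _ (- s ^+ 2 * (z - (2 * x ^+ 2 - x ^+ 2 * y + y ^+ 2 - 2)))).
      by rewrite H mulr0.
    rewrite zE.
    transitivity (2 * x ^+ 2 * s ^+ 2 - x ^+ 2 * y * s ^+ 2 + y ^+ 2 * s ^+ 2).
      by rewrite xs ys2 s2; ring.
    by ring.
  have x0 : x != 0.
    apply: contra_neq n0 => xE; move: xc; rewrite xE expr0n mul0r => /eqP.
    by rewrite eq_sym oppr_eq0 => /eqP.
  have e1 : e = 1.
    move/eqP: e2; rewrite sqrf_eq1 => /orP[/eqP //|/eqP eE].
    have qE : q = 0.
      apply: (@mulfI _ 2); first by rewrite pnatr_eq0.
      by rewrite qe eE mulr0 subrr.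
    by move/eqP: T0; rewrite qE mulr0 add0r mulf_eq0 (negPf x0) (negPf s0).
  have qE : q = 1.
    by apply: (@mulfI _ 2); rewrite ?pnatr_eq0 // qe e1 mulr1.
  have xc1 : x * (c - 1) = - 2.
    by apply: (lc _ _ _ T0); rewrite qE sE e1; ring.
  apply: sq0.
  transitivity ((c - 1) ^+ 2 + (- 2) ^+ 2 * (2 * c ^+ 2 - c)); first by ring.
  rewrite -xc1.
  transitivity ((c - 1) ^+ 2 * (x ^+ 2 * (2 * c ^+ 2 - c) + 1)); first by ring.
  by rewrite xc; ring.
have t0 : z * s - 2 * p - 2 != 0.
  apply: contra_neq n0 => tE; move/eqP: Equ; rewrite tE mulf_eq0 (negPf zn2) orbF.
  move/eqP=> qE; move/eqP: Equq; rewrite qE mul0r eq_sym mulf_eq0 (negPf zp2) /=.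
  by rewrite expf_eq0 (negPf s0).
have tx : z * s - 2 * p - 2 = x * (s - p - 1).
  apply: (@mulfI _ 2); first by rewrite pnatr_eq0.
  apply: (lc _ _ ((z - 2) * ((2 - x) * q + x * s))); first by rewrite T0 mulr0.
  by rewrite (twist_torsion x Equ); ring.
have [x0 d0] : x != 0 /\ s - p - 1 != 0.
  by move: t0; rewrite tx mulf_eq0 negb_or => /andP.
have y2 : y - 2 != 0.
  apply: contra_neq zn2 => yE; transitivity (- (y - 2) * (x ^+ 2 - y - 2)).
    by rewrite Ez; ring.
  by rewrite yE oppr0 mul0r.
have sp0 : s - p != 0.
  apply: contra_neq n0 => spE; move: Ex; rewrite spE !mulr0 sub0r => /eqP.
  by rewrite eq_sym oppr_eq0 => /eqP.
(* By [Ex] the left side of [El] is [(z + 2) s (s - p) (t0^2 - x^2 d^2)], which vanishes because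
   [t0 = x d]. *)
have lE : l = 2.
  apply: (mulIf t0); apply: (lc _ _ ((l - 2) * (z * s - 2 * p - 2))); last by ring.
  by rewrite -El -Ex tx; ring.
have hE : h = 0.
  apply: sq0; move/eqP: Eh; rewrite lE.
  have -> : 2 ^+ 2 - 4 = 0 :> K by ring.
  have -> : z ^+ 2 - 4 = (z - 2) * (z + 2) by ring.
  by rewrite eq_sym mulf_eq0 mulf_eq0 (negPf zn2) (negPf zp2) => /eqP.
(* If [x^2 s = 2 y s], eliminating [x] and combining with [h = 0] gives [(s - p)^2 (s + p) = 0].
   Hence [p = - s], and the relation [e1] becomes [(z + 2) s^2 = 0]. *)
split=> //; split=> //; apply: contra_neq zp2 => g0.
have ys : y * s = s + p by rewrite Ep; ring.
have e1 : (z - 1) * s ^+ 2 - 2 * s * p + p ^+ 2 = 0.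
  have : x ^+ 2 * s * (s - p) = 2 * (s + p) * (s - p).
    by apply: (lc _ _ ((x ^+ 2 * s - 2 * y * s) * (s - p)));
      [rewrite g0 mul0r | rewrite -ys; ring].
  rewrite Ex => e1; apply: (lc _ _ ((z + 2) * s * (s - p) - 1 - 2 * (s + p) * (s - p))).
    by rewrite e1 subrr.
  by ring: Eq.
have e2 : (s - p) ^+ 2 * (s + p) = 0.
  apply: (lc _ _ (h - s * ((z - 1) * s ^+ 2 - 2 * s * p + p ^+ 2))).
    by rewrite hE e1 mulr0 subrr.
  by rewrite Ehd; ring.
have pE : p = - s.
  move/eqP: e2; rewrite mulf_eq0 expf_eq0 (negPf sp0) /= addrC addr_eq0.
  by move/eqP.
apply: (@mulIf _ (s ^+ 2)); first by rewrite expf_eq0 (negPf s0).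
by rewrite mul0r -[RHS]e1 pE; ring.
Qed.

(** * Contact of the two curves at a common zero *)

Section TwistKnotCurves.
Variables (K : numFieldType) (n : int).
Local Notation A := {poly {poly K}}.

(** Bundled as a ring morphism so that identities between integer polynomials carry over to the
    plane by applying it to both sides. *)
Let at_zK : {rmorphism {poly int} -> A} := horner_eval (extXY K zXY) \o map_poly intr.

Lemma extXY_at_z p : extXY K (at_z p) = at_zK p.
Proof.
rewrite /extXY /at_z -horner_map /= -map_poly_comp /horner_eval.
by congr _.[_]; apply: eq_map_poly => m /=; rewrite !rmorph_int.
Qed.

Lemma at_zKX : at_zK 'X = extXY K zXY.
Proof. by rewrite /= map_polyX /horner_eval hornerX. Qed.

Lemma extXY_z :
  extXY K zXY = 2 * 'X ^+ 2 - 'X ^+ 2 * 'Y + 'Y ^+ 2 - 2.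
Proof.
rewrite /extXY /zXY !(rmorph_nat, rmorphB, rmorphD, rmorphM, rmorphXn) /=.
by rewrite !(map_polyX, map_polyC) /= map_polyX.
Qed.

Local Notation Z := (extXY K zXY).
Local Notation S := (at_zK (chebS n)).
Local Notation P := (at_zK (chebS (n - 1))).
Local Notation S' := (at_zK (chebS n)^`()).
Local Notation P' := (at_zK (chebS (n - 1))^`()).
Local Notation Q := (at_zK (torsion_quot n)).
Local Notation F := (extXY K (f_ n)).
Local Notation T := (extXY K (tau_ n)).
Local Notation N := (n%:~R : A).

Let at_zKE := (rmorph_nat at_zK, rmorph_int at_zK, rmorph1 at_zK, rmorphB at_zK,
  rmorphD at_zK, rmorphM at_zK, rmorphXn at_zK, at_zKX).

Lemma at_zK_quad : P ^+ 2 = 1 + Z * S * P - S ^+ 2.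
Proof. by have := congr1 at_zK (chebS_quad n); rewrite !at_zKE. Qed.

Lemma at_zK_deriv :
  (Z ^+ 2 - 4) * S' = N * (Z * S - 2 * P) - Z * S /\
  (Z ^+ 2 - 4) * P' = (N - 1) * (2 * S - Z * P) - Z * P.
Proof.
have [dS dP] := chebS_deriv n.
by have := congr1 at_zK dS; have := congr1 at_zK dP; rewrite !at_zKE.
Qed.

Lemma at_zK_quot : Q * (Z - 2) = Z * S - 2 * P - 2.
Proof. by have := congr1 at_zK (torsion_quotX n); rewrite !at_zKE. Qed.

Lemma at_zK_quot_quad : Q * (Q * (Z - 2) + 4) = (Z + 2) * S ^+ 2.
Proof. by have := congr1 at_zK (torsion_quot_quad n); rewrite !at_zKE. Qed.

Lemma f_E : F = ('Y - 1) * S - P.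
Proof.
rewrite -!extXY_at_z /extXY /f_ !(rmorph1, rmorphB, rmorphM) /=.
by rewrite map_polyC /= map_polyX.
Qed.

Lemma tau_E : T = (2 - 'X) * Q + 'X * S.
Proof.
rewrite -!extXY_at_z /extXY /tau_ !(rmorph_nat, rmorphB, rmorphM, rmorphD) /=.
by rewrite map_polyX.
Qed.

Local Notation H := (cheb3 Z S P).
Local Notation L := (lucas3 Z S P).

Lemma dir_at_zK α β p : dir α β (at_zK p) = at_zK p^`() * dir α β Z.
Proof. exact: dir_comp. Qed.

(** This is the first formula of [chebS_deriv] at the index [3n - 1], composed with [z]: [H] is
    [S_(3n-1)(z)] and [L] is [t^(3n-1) + t^(1-3n)]. *)
Lemma dir_H α β :
  (Z ^+ 2 - 4) * dir α β H = ((3 * N - 1) * L - Z * H) * dir α β Z.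
Proof.
have [dS dP] := at_zK_deriv; have E := at_zK_quad.
have -> : H = Z * (S * (S * S)) - 3%:R * (S * S * P) + P * (P * P).
  by rewrite /cheb3; ring.
rewrite !(dir_nat, dirB, dirD, dirM) !dir_at_zK /lucas3.
move: S P S' P' (dir α β Z) dS dP E => s p s' p' D dS dP E.
transitivity (D * ((Z ^+ 2 - 4) * s ^+ 3 + ((Z ^+ 2 - 4) * s') *
   (3 * Z * s ^+ 2 - 6 * s * p) + ((Z ^+ 2 - 4) * p') * (3 * p ^+ 2 - 3 * s ^+ 2))).
  by ring.
by rewrite dS dP; ring: E.
Qed.

Lemma dir_Z α β :
  dir α β Z = α%:P%:P * (2 * 'X * (2 - 'Y)) + β%:P%:P * (2 * 'Y - 'X ^+ 2).
Proof.
rewrite extXY_z !(dir_nat, dir_X, dir_Y, dirB, dirD, dirXn, dirM).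
by ring.
Qed.

Lemma dir_f α β :
  dir α β F = β%:P%:P * S + (('Y - 1) * S' - P') * dir α β Z.
Proof.
by rewrite f_E !(dir_nat _ _ 1, dir_Y, dir_at_zK, dirB, dirM); ring.
Qed.

Variables a b : K.
Hypotheses (F0 : F.[a, b] = 0) (T0 : T.[a, b] = 0).

Let ev : {rmorphism A -> K} := horner_eval b \o horner_eval a%:P.

Let evE := (rmorph_nat ev, rmorph_int ev, rmorph1 ev, rmorphN ev, rmorphB ev,
  rmorphD ev, rmorphM ev, rmorphXn ev).

Let evX : ev 'X = a. Proof. by rewrite /= /horner_eval !hornerE. Qed.
Let evY : ev 'Y = b. Proof. by rewrite /= /horner_eval !hornerE. Qed.
Let evC α : ev α%:P%:P = α. Proof. by rewrite /= /horner_eval !hornerE. Qed.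

Lemma ev_at_zK p : ev (at_zK p) = (map_poly intr p).[ev Z].
Proof.
rewrite -[LHS]/(ev (map_poly intr p).[Z]) -(horner_map ev) -map_poly_comp.
by congr _.[_]; apply: eq_map_poly => m; rewrite [LHS]rmorph_int.
Qed.

Lemma ev_at_z2 m : ev Z = 2 -> ev (at_zK (chebS m)) = m%:~R.
Proof.
rewrite ev_at_zK => ->; have [+ _] := cheb_pair2 m; rewrite -/(chebS m) => E.
rewrite -[2]/(intr (2 : int)) (horner_map (intmul 1 : {rmorphism int -> K})) /=.
by rewrite E.
Qed.

Local Notation z := (ev Z).
Local Notation s := (ev S).
Local Notation p := (ev P).

Let ev_cheb3 : ev H = cheb3 z s p.
Proof. by rewrite /cheb3 !evE. Qed.

Let ev_lucas3 : ev L = lucas3 z s p.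
Proof. by rewrite /lucas3 !evE. Qed.

Lemma ev_common_zero :
  [/\ [/\ s != 0, z - 2 != 0, z + 2 != 0 & z * s - 2 * p - 2 != 0],
      [/\ a != 0, b - 2 != 0, s - p != 0 & s - p - 1 != 0],
      z * s - 2 * p - 2 = a * (s - p - 1) &
      [/\ ev L = 2, ev H = 0 & a ^+ 2 * s - 2 * b * s != 0]].
Proof.
rewrite ev_cheb3 ev_lucas3; apply: (@twist_common_zero _ n%:~R _ _ _ _ _ (ev Q)).
- have -> : 3 * n%:~R = (3 * n)%:~R :> K by rewrite intrM.
  by rewrite -[X in _ != X]/(1%:~R) eqr_int; lia.
- by have := congr1 ev extXY_z; rewrite !(evE, evX, evY).
- by have := congr1 ev at_zK_quad; rewrite !evE.
- by have := congr1 ev at_zK_quot; rewrite !evE.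
- by have := congr1 ev at_zK_quot_quad; rewrite !evE.
- by move=> zE; rewrite !ev_at_z2 // rmorphB.
(* At [z = -2] the factor [z^2 - 4] kills the derivative, and what remains of the formula is a
   relation between the values. *)
- have [dS _] := at_zK_deriv; move/(congr1 ev): dS; rewrite !evE => dS zE.
  move/eqP: dS; rewrite zE; have -> : (- 2) ^+ 2 - 4 = 0 :> K by ring.
  rewrite mul0r eq_sym => /eqP e8.
  apply: (@mulfI _ 2); first by rewrite pnatr_eq0.
  by apply/eqP; rewrite -subr_eq0 -e8; apply/eqP; ring.
- by rewrite -evY -(rmorph1 ev) -rmorphB -rmorphM -rmorphB -f_E; exact: F0.
- rewrite -evX -(rmorph_nat ev 2) -rmorphB -!rmorphM -rmorphD -tau_E.
  exact: T0.
Qed.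

Lemma torsion_contact : simple_contact F T a b.
Proof.
have [[s0 z20 zp20 t0] [a0 b20 sp0 d0] tE [LE HE g0]] := ev_common_zero.
have zE : z ^+ 2 - 4 = (z - 2) * (z + 2) by ring.
have dF α β : ev (dir α β F) =
    β * s + ((b - 1) * ev S' - ev P') * ev (dir α β Z).
  by rewrite dir_f !(evE, evC, evY).
have dZ α β : ev (dir α β Z) = α * (2 * a * (2 - b)) + β * (2 * b - a ^+ 2).
  by rewrite dir_Z !(evE, evC, evX, evY).
have n3 : 3 * n%:~R - 1 != 0 :> K.
  have -> : 3 * n%:~R - 1 = (3 * n - 1)%:~R :> K by rewrite intrB intrM.
  by rewrite intr_eq0; lia.
have nat0 m : m.+1%:R != 0 :> K by rewrite pnatr_eq0.
have four0 : 2 + 2 != 0 :> K by rewrite -natrD pnatr_eq0.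
have zX0 : 2 * a * (2 - b) != 0 by rewrite !mulf_neq0 // -opprB oppr_eq0.
have := twist_contact_eq extXY_z at_zK_quad at_zK_quot.
rewrite -f_E -tau_E => /= E.
apply: (simple_contactI F0 T0 _ E).
- exact: HE.
(* At the point [l + 2 = 4], and [t0 = x d] turns the conjugate factor [t0 + x d] into [2 t0]. *)
- rewrite -[_.[_, _]]/(ev _) !(evX, ev_lucas3, evE) -ev_lucas3 LE -tE.
  have -> : z * s - 2 * p - 2 + (z * s - 2 * p - 2) = 2 * (z * s - 2 * p - 2) by ring.
  by rewrite !mulf_neq0.
- by rewrite -[_.[_, _]]/(ev _) !evE zE !mulf_neq0.
- rewrite -[_.[_, _]]/(ev _) !(evX, evY, ev_lucas3, evE) -ev_lucas3 LE.
  by rewrite [ev F]F0 addr0 !mulf_neq0 ?expf_neq0 ?oppr_eq0.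
(* The differential of [f] is [s dy + ph dz]. Since [z] has nonzero [x]-derivative, a vanishing
   gradient forces [ph = 0], and then [s = 0]. *)
- rewrite -negb_and; apply: contra s0 => /andP[/eqP x0 /eqP y0].
  have dF0 α β : ev (dir α β F) = 0.
    by rewrite [LHS]horner2_dir x0 y0 !mulr0 addr0.
  have ph : (b - 1) * ev S' - ev P' = 0.
    apply: (mulIf zX0); have := dF0 1 0.
    by rewrite dF dZ !mul0r mul1r add0r addr0.
  by have := dF0 0 1; rewrite dF ph mul0r addr0 mul1r => ->.
(* With [L = 2] and [H = 0], [dir_H] makes [dH] a nonzero multiple of [dz]. If [df] and [dz] both
   vanish on a direction, then so do [s β] and afterwards [2 a (2 - b) α]. *)
- move=> α β n0 dF0; apply: contraTneq n0 => dH0.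
  have dZ0 : ev (dir α β Z) = 0.
    have := congr1 ev (dir_H α β); rewrite !(ev_cheb3, ev_lucas3, evE).
    rewrite -ev_cheb3 -ev_lucas3 LE HE [ev (dir _ _ H)]dH0 !mulr0 subr0.
    by move/esym/eqP; rewrite !mulf_eq0 (negPf n3) pnatr_eq0 => /eqP.
  have b0 : β = 0.
    have := dF α β; rewrite [LHS]dF0 dZ0 mulr0 addr0 => /esym/eqP.
    by rewrite mulf_eq0 (negPf s0) orbF => /eqP.
  have := dZ α β; rewrite dZ0 b0 mul0r addr0 => /esym/eqP.
  by rewrite mulf_eq0 (negPf zX0) orbF => /eqP ->; rewrite eqxx.
Qed.

End TwistKnotCurves.

(** * Powers of the ideal of a point and multiplicity *)

Lemma ideal_gen1P (R : comNzRingType) (f r : R) :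
  ideal_gen [:: f] r <-> exists c, r = c * f.
Proof.
split=> [[c ->]|[c ->]]; first by exists (c ord0); rewrite big_ord_recl big_ord0 addr0.
by exists (fun=> c); rewrite big_ord_recl big_ord0 addr0.
Qed.

Lemma ideal_gen2P (R : comNzRingType) (f g r : R) :
  ideal_gen [:: f; g] r <-> exists c d, r = c * f + d * g.
Proof.
split=> [[c ->]|[c [d ->]]].
  exists (c ord0), (c (lift ord0 ord0)).
  by rewrite !big_ord_recl big_ord0 addr0.
exists (fun i => if i == ord0 then c else d).
by rewrite !big_ord_recl big_ord0 addr0.
Qed.

Lemma ideal_mul_ind (R : comNzRingType) (J1 J2 : set R) (Pr : R -> Prop) :
    Pr 0 -> (forall u v, Pr u -> Pr v -> Pr (u + v)) ->
    (forall u v, J1 u -> J2 v -> Pr (u * v)) ->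
  forall u, ideal_mul J1 J2 u -> Pr u.
Proof.
move=> P0 PD PM u [s sJ ->]; rewrite big_seq.
by elim/big_ind: _ => // w /sJ[]; apply: PM.
Qed.

Section Multiplicity.
Variables (K : numFieldType) (a b : K).
Local Notation A := {poly {poly K}}.
Local Notation I := (point_ideal a b).
Implicit Types u v : A.

(** The factor theorem, applied first in the outer variable and then to the remaining polynomial in
    the inner one. *)
Lemma point_idealP u : I u <-> u.[a, b] = 0.
Proof.
split=> [/ideal_gen2P[c [d ->]]|u0].
  by rewrite !(horner2D, horner2M) !hornerE /= !(hornerE, subrr, mulr0).
have /factor_theorem[c uE] : root (u - u.[a%:P]%:P) a%:P.
  by rewrite /root !hornerE subrr.
have /factor_theorem[d dE] : root u.[a%:P] b by rewrite /root u0.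
apply/ideal_gen2P; exists c, d%:P.
by rewrite -uE -rmorphB -rmorphM /= -dE subrK.
Qed.

(** The cofactors are not unique, but the Leibniz rule fixes their values at the point. *)
Lemma point_ideal_linear u : u.[a, b] = 0 ->
  exists c d, [/\ u = c * ('X - a%:P%:P) + d * ('Y - b%:P%:P),
    c.[a, b] = (dX u).[a, b] & d.[a, b] = (dY u).[a, b]].
Proof.
move=> /point_idealP/ideal_gen2P[c [d uE]]; exists c, d.
have X0 : ('X - a%:P%:P : A).[a, b] = 0 by rewrite !hornerE subrr.
have Y0 : ('Y - b%:P%:P : A).[a, b] = 0 by rewrite !hornerE subrr.
have dE α β : (dir α β u).[a, b] = c.[a, b] * α + d.[a, b] * β.
  rewrite uE dirD !dirM 3!horner2D !horner2M X0 Y0 !mulr0 !add0r.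
  by rewrite !dirB dir_X dir_Y !dir_C !subr0 !hornerE.
split=> //.
  by have := dE 1 0; rewrite horner2_dir !mul1r !mul0r mulr0 mulr1 !addr0 => ->.
by have := dE 0 1; rewrite horner2_dir !mul1r !mul0r mulr0 mulr1 !add0r => ->.
Qed.

(** By definition the first power is the product of the ideal with the whole ring, whence the factor
    1 in the witness. *)
Lemma ideal_pow1 u : ideal_pow I 1 u <-> u.[a, b] = 0.
Proof.
split=> [|/point_idealP u0].
  elim/ideal_mul_ind => [|v w v0 w0|v w /point_idealP v0 _].
  - by rewrite !horner0.
  - by rewrite horner2D v0 w0 addr0.
  - by rewrite horner2M v0 mul0r.
by exists [:: (u, 1)] => [v /[!inE] /eqP -> //|]; rewrite big_seq1 mulr1.
Qed.

(** For the converse, the cofactors of [point_ideal_linear] vanish at the point together with the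
    partial derivatives, so they lie in the ideal themselves. *)
Lemma ideal_pow2 u : ideal_pow I 2 u <->
  u.[a, b] = 0 /\ forall α β, (dir α β u).[a, b] = 0.
Proof.
split=> [|[u0 du0]].
  elim/ideal_mul_ind => [|v w [v0 dv] [w0 dw]|v w /point_idealP v0 /ideal_pow1 w0].
  - by rewrite !horner0; split=> // α β; rewrite raddf0 !horner0.
  - by split=> [|α β]; rewrite ?dirD horner2D ?v0 ?w0 ?dv ?dw addr0.
  - by split=> [|α β]; rewrite ?dirM ?horner2D !horner2M v0 ?w0 ?mul0r ?mulr0 ?addr0.
have [c [d [uE cE dE]]] := point_ideal_linear u0.
have c0 : c.[a, b] = 0.
  by rewrite cE; have := du0 1 0; rewrite horner2_dir mul1r mul0r addr0.
have d0 : d.[a, b] = 0.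
  by rewrite dE; have := du0 0 1; rewrite horner2_dir mul1r mul0r add0r.
have X0 : ('X - a%:P%:P : A).[a, b] = 0 by rewrite !hornerE subrr.
have Y0 : ('Y - b%:P%:P : A).[a, b] = 0 by rewrite !hornerE subrr.
exists [:: ('X - a%:P%:P, c); ('Y - b%:P%:P, d)] => [v|].
  by rewrite !inE => /orP[] /eqP ->; split;
    (exact/point_idealP || exact/ideal_pow1).
by rewrite big_cons big_seq1 /= uE; ring.
Qed.

Lemma ideal_pow3 u : ideal_pow I 3 u ->
  forall α β, (dir α β (dir α β u)).[a, b] = 0.
Proof.
move=> u3 α β; move: u u3; apply: ideal_mul_ind => [|v w v0 w0|v w].
- by rewrite !raddf0 !horner0.
- by rewrite !dirD horner2D v0 w0 addr0.
move=> /point_idealP v0 /ideal_pow2[w0 dw].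
by rewrite !(dirM, dirD) !(horner2D, horner2M) v0 w0 dw !(mulr0, mul0r, addr0).
Qed.

Lemma ideal_pow3_sub u : ideal_pow I 3 u -> ideal_pow I 2 u.
Proof.
elim/ideal_mul_ind => [|v w v2 w2|v w /point_idealP v0 /ideal_pow2[w0 dw]].
- by apply/ideal_pow2; split=> [|α β]; rewrite ?raddf0 !horner0.
- move/ideal_pow2: v2 => [v0 dv]; move/ideal_pow2: w2 => [w0 dw].
  by apply/ideal_pow2; split=> [|α β]; rewrite ?dirD horner2D ?v0 ?w0 ?dv ?dw addr0.
- apply/ideal_pow2; split=> [|α β]; first by rewrite horner2M v0 mul0r.
  by rewrite dirM horner2D !horner2M v0 w0 mul0r mulr0 addr0.
Qed.

(** The difference [v - r u] has zero 1-jet. If [v - c u] were in the cube, first derivatives would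
    give [c = r] at the point, as the gradient of [u] is nonzero. Along the tangent, the gradient
    turned by a right angle, derivatives of [c] drop out of the second derivative, contradicting the
    contact condition. *)
Lemma simple_contact_multiplicity u v :
  simple_contact u v a b -> zero_multiplicity u v a b 2.
Proof.
case=> u0 v0 gr [r r0 [d1 d2]]; split.
  exists (v - r%:P%:P * u); last by apply/ideal_gen1P; exists r%:P%:P; rewrite subKr.
  apply/ideal_pow2; split=> [|α β].
    by rewrite !hornerE v0 u0 mulr0 subr0.
  rewrite dirB dirM dir_C mul0r add0r hornerD hornerN hornerD hornerN horner2M.
  by rewrite d1 !hornerE subrr.
case=> w w3 /ideal_gen1P[c /(canRL (subrK _)) vE].
have [w0 dw] := (ideal_pow2 w).1 (ideal_pow3_sub w3); have ddw := ideal_pow3 w3.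
have d1' α β : (dir α β v).[a, b] = c.[a, b] * (dir α β u).[a, b].
  by rewrite vE !(dirD, dirM, horner2D, horner2M) u0 dw mulr0 add0r addr0.
have cE : c.[a, b] = r.
  case/orP: gr => g0; apply: (mulIf g0).
  - by have := d1' 1 0; rewrite d1 !horner2_dir !mul1r !mul0r !addr0.
  - by have := d1' 0 1; rewrite d1 !horner2_dir !mul1r !mul0r !add0r.
pose α := - (dY u).[a, b]; pose β := (dX u).[a, b].
have n0 : (α != 0) || (β != 0) by rewrite oppr_eq0 orbC.
have t0 : (dir α β u).[a, b] = 0 by rewrite horner2_dir /α /β; ring.
have /eqP := d2 α β n0 t0; apply.
rewrite vE !(dirD, dirM, horner2D, horner2M) u0 t0 ddw cE.
by rewrite !(mulr0, add0r, addr0).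
Qed.

End Multiplicity.

(** * Implicit functions of real bivariate polynomials *)

Section ImplicitFunction.
Variable R : realType.
Implicit Types (p u v : {poly {poly R}}) (g h : R -> R) (a b x y : R).

Lemma is_derive_horner_comp (c : {poly R}) g x k : is_derive x 1 g k ->
  is_derive x 1 (fun t => c.[g t]) (c^`().[g x] * k).
Proof.
move=> dg; elim/poly_ind: c => [|c r IH].
  have -> : (fun t => (0 : {poly R}).[g t]) = cst 0.
    by apply/funext => t; rewrite horner0.
  by rewrite raddf0 horner0 mul0r; exact: is_derive_cst.
have -> : (fun t => (c * 'X + r%:P).[g t]) = (fun t => c.[g t]) * g + cst r.
  by apply/funext => t; rewrite hornerMXaddC.
apply: is_derive_eq; rewrite derivD derivC derivM derivX mulr1 !addr0.
by rewrite hornerD hornerM hornerX /GRing.scale /=; ring.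
Qed.

Lemma is_derive_horner2 p g x k : is_derive x 1 g k ->
  is_derive x 1 (fun t => p.[t, g t]) (dir 1 k p).[x, g x].
Proof.
move=> dg; elim/poly_ind: p => [|p c IH].
  have -> : (fun t => (0 : {poly {poly R}}).[t, g t]) = cst 0.
    by apply/funext => t; rewrite !horner0.
  by rewrite raddf0 !horner0; exact: is_derive_cst.
have -> : (fun t => (p * 'X + c%:P).[t, g t]) =
    (fun t => p.[t, g t]) * id + (fun t => c.[g t]).
  by apply/funext => t; rewrite hornerMXaddC hornerD hornerM hornerC.
have dc := is_derive_horner_comp c dg.
apply: is_derive_eq; rewrite !dirE dXMXaddC dYMXaddC.
by rewrite !(horner2D, horner2M) !hornerE /GRing.scale /=; ring.
Qed.

Local Open Scope classical_set_scope.

Lemma continuous_horner2 p : continuous (fun z : R * R => p.[z.1, z.2]).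
Proof.
move=> z; elim/poly_ind: p => [|p c IH].
  under eq_fun do rewrite !horner0; exact: cvg_cst.
under eq_fun do rewrite hornerMXaddC hornerD hornerM hornerC.
apply: cvgD; first by apply: cvgM => //; exact: cvg_fst.
by apply: (cvg_comp _ _ cvg_snd); exact: continuous_horner.
Qed.

Lemma cvg_horner2 p (T : Type) (F : set_system T) {FF : Filter F} (s t : T -> R) x y :
  s @ F --> x -> t @ F --> y -> p.[s z, t z] @[z --> F] --> p.[x, y].
Proof.
move=> sx ty; have st : (s z, t z) @[z --> F] --> ((x, y) : R * R).
  exact: (@cvg_pair _ _ _ F (nbhs x) (nbhs y) FF _ _ s t sx ty).
exact: (cvg_comp _ _ st (@continuous_horner2 p (x, y))).
Qed.

(* Writing [p = c (X - x) + d (Y - g x)] turns the difference quotient of [g] at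
   [x] into [- c / d] along the curve. *)
Lemma is_derive_implicit p g x : {for x, continuous g} ->
    (\forall t \near x, p.[t, g t] = 0) -> (dY p).[x, g x] != 0 ->
  is_derive x 1 g (- (dX p).[x, g x] / (dY p).[x, g x]).
Proof.
move=> cg p0 dp0.
have [c [d [pE cE dE]]] := point_ideal_linear (nbhs_singleton p0).
(* This is the shape of the shifted argument in the definition of the derivative in direction 1. *)
pose s (k : R) := k *: (1 : R) + x.
have sx : s k @[k --> 0^'] --> x.
  rewrite -[X in _ --> X]add0r; apply: cvgD; last exact: cvg_cst.
  under eq_fun do rewrite [_ *: _]mulr1.
  exact: cvg_within.
have gx : g (s k) @[k --> 0^'] --> g x by exact: (cvg_comp _ _ sx cg).
have cx : c.[s k, g (s k)] @[k --> 0^'] --> c.[x, g x] by exact: cvg_horner2.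
have dx : d.[s k, g (s k)] @[k --> 0^'] --> d.[x, g x] by exact: cvg_horner2.
have d0 : d.[x, g x] != 0 by rewrite dE.
have lx : - c.[s k, g (s k)] / d.[s k, g (s k)] @[k --> 0^'] -->
    - (dX p).[x, g x] / (dY p).[x, g x].
  rewrite -cE -dE; apply: cvgM; [exact: cvgN cx|exact: cvgV d0 dx].
have {}lx : k^-1 *: (g (s k) - g x) @[k --> 0^'] -->
    - (dX p).[x, g x] / (dY p).[x, g x].
  apply: cvg_trans lx; apply: near_eq_cvg; near=> k.
  have k0 : k != 0 by near: k; exact: nbhs_dnbhs_neq.
  have dk0 : d.[s k, g (s k)] != 0.
    by near: k; exact: (cvgr_neq0 _ dx d0).
  have : p.[s k, g (s k)] = 0 by near: k; exact: (sx _ p0).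
  have sk : s k - x = k by rewrite /s addrK [_ *: _]mulr1.
  rewrite pE horner2D !horner2M !hornerE sk.
  move: (c.[_, _]) (d.[_, _]) (g (s k) - g x) dk0 => c' d' w dk0 E.
  have -> : w = - (c' * k) / d'.
    by apply: (mulfI dk0); rewrite [RHS]mulrC divfK // -[LHS]subr0 -E; ring.
  by rewrite /GRing.scale /=; field; rewrite k0 dk0.
apply: DeriveDef; first exact: (cvgP _ lx).
exact: (cvg_lim _ lx).
Unshelve. all: by end_near. Qed.

(** On a small box [s p] increases in [y] with slope at least [s^2 / 2]: the intermediate value
    theorem gives a zero on each vertical segment, and the slope bound its uniqueness and
    continuity. Continuity is asserted on a neighbourhood because second derivatives require [g']
    near [a]. *)
Lemma implicit_function_exists p a b : p.[a, b] = 0 -> (dY p).[a, b] != 0 ->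
  exists g, [/\ g a = b,
    \forall x \near a, {for x, continuous g} /\ p.[x, g x] = 0 &
    \forall z \near ((a, b) : R * R), p.[z.1, z.2] = 0 <-> z.2 = g z.1].
Proof.
move=> p0; set s := (dY p).[a, b] => s0.
(* Half the value of [s] times the [y]-derivative at the point; multiplying by [s] treats both signs
   at once. *)
have s20 : 0 < s ^+ 2 / 2 by rewrite divr_gt0 // exprn_even_gt0.
have [e e0 dpe] : exists2 e : R, 0 < e & forall x y, `|a - x| < e -> `|b - y| < e ->
    s ^+ 2 / 2 < s * (dY p).[x, y].
  have sdp : s * (dY p).[z.1, z.2] @[z --> ((a, b) : R * R)] --> s * s.
    by apply: cvgM; [exact: cvg_cst|exact: (@continuous_horner2 (dY p) (a, b))].
  have ss : s ^+ 2 / 2 < s * s.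
    by rewrite -expr2 ltr_pdivrMr // ltr_pMr ?exprn_even_gt0 // ltr1n.
  have /nbhs_ballP[e e0 He] : \forall z \near ((a, b) : R * R),
      s ^+ 2 / 2 < s * (dY p).[z.1, z.2] by exact: (cvgr_gt _ sdp).
  by exists e => // x y ax bY; exact: (He (x, y)).
have slope x y1 y2 : `|a - x| < e -> `|b - y1| < e -> `|b - y2| < e -> y1 <= y2 ->
    s ^+ 2 / 2 * (y2 - y1) <= s * (p.[x, y2] - p.[x, y1]).
  move=> ax b1 b2; rewrite le_eqVlt => /predU1P[->|y12]; first by rewrite !subrr !mulr0.
  have [c cI ->] := poly_mvt p.[x%:P] y12.
  rewrite -horner_dY mulrA ler_wpM2r ?subr_ge0 ?(ltW y12) //; apply/ltW/dpe => //.
  move: cI b1 b2; rewrite in_itv /= !ltr_norml => /andP[? ?] /andP[? ?] /andP[? ?].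
  by apply/andP; split; lra.
have inj x y1 y2 : `|a - x| < e -> `|b - y1| < e -> `|b - y2| < e ->
    s ^+ 2 / 2 * `|y1 - y2| <= `|s * (p.[x, y1] - p.[x, y2])|.
  move=> ax b1 b2; have [y12|/ltW y12] := leP y1 y2.
    rewrite ler0_norm ?subr_le0 // opprB; apply: le_trans (slope x _ _ ax b1 b2 y12) _.
    by rewrite -normrN -mulrN opprB ler_norm.
  rewrite ger0_norm ?subr_ge0 //; apply: le_trans (slope x _ _ ax b2 b1 y12) _.
  exact: ler_norm.
(* Halving keeps [b - d] and [b + d] strictly inside the box. *)
pose d := e / 2; have d0 : 0 < d by rewrite divr_gt0.
pose Q x := [/\ `|a - x| < e, s * p.[x, b - d] < 0 & 0 < s * p.[x, b + d]].
have bd : `|b - (b - d)| < e /\ `|b - (b + d)| < e.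
  by rewrite /d !ltr_norml; split; apply/andP; split; lra.
have bb : `|b - b| < e by rewrite subrr normr0.
have aa : `|a - a| < e by rewrite subrr normr0.
have Qa : \forall x \near a, Q x.
  have sp y : s * p.[x, y] @[x --> a] --> s * p.[a, y].
    by apply: cvgM; [exact: cvg_cst|apply: cvg_horner2; [exact: cvg_id|exact: cvg_cst]].
  have sd0 : 0 < s ^+ 2 / 2 * d by rewrite mulr_gt0.
  near=> x; split.
  - by near: x; exact: nbhsx_ballx.
  - near: x; apply: (cvgr_lt _ (sp _)).
    have := slope a (b - d) b aa bd.1 bb; rewrite p0 sub0r mulrN => H.
    have : s ^+ 2 / 2 * (b - (b - d)) <= - (s * p.[a, b - d]) by apply: H; lra.
    rewrite (_ : b - (b - d) = d) //; lra.
  - near: x; apply: (cvgr_gt _ (sp _)).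
    have := slope a b (b + d) aa bb bd.2; rewrite p0 subr0 => H.
    have : s ^+ 2 / 2 * (b + d - b) <= s * p.[a, b + d] by apply: H; lra.
    rewrite (_ : b + d - b = d) //; lra.
pose Z x := [set y | `|b - y| < e /\ p.[x, y] = 0].
(* The default [b] is returned only where [Z x] is empty, which [Q x] excludes. *)
pose g x := xget b (Z x).
have gP x : Q x -> Z x (g x).
  move=> [ax sm sp]; apply: xgetPex.
  have lebd : b - d <= b + d by lra.
  have [|y yI /eqP y0] := @polyrcf.poly_ivt _ p.[x%:P] _ _ lebd.
    rewrite -(@pmulr_rle0 _ (s ^+ 2)) ?exprn_even_gt0 //.
    rewrite (_ : _ * _ = s * p.[x, b - d] * (s * p.[x, b + d])); last by ring.
    by rewrite nmulr_rle0 // ltW.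
  exists y; split=> //; move: yI; rewrite in_itv /= /d ltr_norml => /andP[? ?].
  by apply/andP; split; lra.
have gU x y : Q x -> Z x y -> y = g x.
  move=> Qx [by1 py]; have [bg pg] := gP x Qx; have [ax _ _] := Qx.
  have := inj x y (g x) ax by1 bg; rewrite py pg subrr mulr0 normr0.
  by rewrite pmulr_rle0 // normr_le0 subr_eq0 => /eqP.
have ga : g a = b by apply/esym/gU => //; exact: nbhs_singleton.
exists g; split=> //.
- near=> x; have Qx : Q x by near: x.
  have Qt : \forall t \near x, Q t by near: x; exact: (near_join Qa).
  have [bg pg] := gP x Qx; split=> //.
  apply/cvgrPdist_lt => k k0; near=> t.
  have Qt' : Q t by near: t.
  have [bgt pgt] := gP t Qt'; have [axt _ _] := Qt'.
  have := inj t (g x) (g t) axt bg bgt; rewrite pgt subr0 => H.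
  rewrite -(ltr_pM2l s20); apply: le_lt_trans H _.
  near: t; have sp0 : `|s * p.[t, g x]| @[t --> x] --> (0 : R).
    rewrite -(normr0 R) -(mulr0 s) -pg; apply: cvg_norm.
    by apply: cvgM; [exact: cvg_cst|apply: cvg_horner2; [exact: cvg_id|exact: cvg_cst]].
  by apply: (cvgr_lt _ sp0); rewrite mulr_gt0.
- near=> z; have Qz : Q z.1 by near: z; exact: (cvg_fst Qa).
  have bz : `|b - z.2| < e.
    by near: z; apply: (cvg_snd (nbhsx_ballx b e e0)).
  split=> [pz|->]; first exact: gU.
  by case: (gP _ Qz).
Unshelve. all: by end_near. Qed.

End ImplicitFunction.

(** * Tangent lines and second derivatives of real curves in contact *)

Section ContactReal.
Variable R : realType.
Implicit Types (p u v : {poly {poly R}}) (g h : R -> R) (a b x y : R).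

(** Here [k = g'(a)]. Near [a] one has [g' = m] with [m v + u = 0]; differentiating this identity
    along the graph at [a] gives the last equation. *)
Lemma implicit_function_derive2 p a b : p.[a, b] = 0 -> (dY p).[a, b] != 0 ->
  exists g k, [/\ implicit_function (fun x y => p.[x, y]) a b g,
    twice_derivable g a, (dir 1 k p).[a, b] = 0 &
    (dir 1 k (dir 1 k p)).[a, b] + (g^`(2) a)%classic * (dY p).[a, b] = 0].
Proof.
move=> p0 s0; have [g [ga gnear gimp]] := implicit_function_exists p0 s0.
pose u x := (dX p).[x, g x]; pose v x := (dY p).[x, g x].
pose m : R -> R := fun x => - u x / v x.
have [cg _] := nbhs_singleton gnear.
have v0 : v a != 0 by rewrite /v ga.
have vnear : \forall x \near a, v x != 0.
  have cv : (v x @[x --> a] --> v a)%classic.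
    by apply: cvg_horner2; [exact: cvg_id|exact: cg].
  exact: (cvgr_neq0 _ cv).
have dg : \forall x \near a, is_derive x (1 : R) g (m x).
  near=> x; have [cgx _] : {for x, continuous g} /\ p.[x, g x] = 0 by near: x.
  apply: is_derive_implicit => //; last by near: x.
  have : \forall t \near x, {for t, continuous g} /\ p.[t, g t] = 0.
    by near: x; exact: (near_join gnear).
  by apply: filterS => t [].
have dga := nbhs_singleton dg.
have du := is_derive_horner2 (dX p) dga; have dv := is_derive_horner2 (dY p) dga.
have dm : derivable m a 1.
  apply: derivableM; first by apply: derivableN; case: du.
  by apply: derivableV => //; case: dv.
have gm : {near a, (g^`())%classic =1 m}.
  near=> x; have dgx : is_derive x 1 g (m x) by near: x.
  by rewrite derive1E derive_val.
have g2 : (g^`(2) a)%classic = 'D_1 m a.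
  by rewrite derive1nS derive1n1 derive1E; exact: near_eq_derive.
exists g, (m a); split.
- by split.
- split; first by apply: filterS dg => x [].
  by apply: (near_eq_derivable _ dm); apply: filterS gm => x.
- by rewrite horner2_dir mul1r /m /u /v ga divfK // subrr.
have dmP := derivableP dm.
have dw := is_deriveD (is_deriveM dmP dv) du.
have w0 : {near a, cst 0 =1 m * v + u}.
  near=> x; have vx : v x != 0 by near: x.
  by rewrite /= /GRing.add /GRing.mul /= /m divfK // addNr.
rewrite -/u -/v in dw; have : 'D_1 (m * v + u) a = 0.
  by rewrite -(near_eq_derive _ w0) //; exact: derive_cst.
rewrite (@derive_val _ _ _ _ _ _ _ dw) g2 => <-.
rewrite [dir _ _ p]dirE dirD !dirM !dir_C.
by rewrite !(horner2D, horner2M) !hornerE /GRing.scale /= /v ga; ring.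
Unshelve. all: by end_near. Qed.

(** Proportional gradients give both functions the same slope [k]. As [v_y = r u_y], equal second
    derivatives would give [D^2 v = r D^2 u] in the tangent direction [(1, k)]. *)
Lemma simple_contact_second_derivatives u v a b : simple_contact u v a b ->
  (dY u).[a, b] != 0 -> (dY v).[a, b] != 0 ->
  implicit_second_derivatives_differ (fun x y => u.[x, y]) (fun x y => v.[x, y]) a b.
Proof.
case=> u0 v0 _ [r r0 [d1 d2]] uy vy.
have [g [k [gI gD gk g2]]] := implicit_function_derive2 u0 uy.
have [h [l [hI hD hl h2]]] := implicit_function_derive2 v0 vy.
exists g, h; split=> //.
have vyE : (dY v).[a, b] = r * (dY u).[a, b].
  by have := d1 0 1; rewrite !horner2_dir !mul0r !mul1r !add0r.
have lk : l = k.
  have hl' : (dir 1 l u).[a, b] = 0.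
    by apply: (mulfI r0); rewrite -d1 hl mulr0.
  by move: gk; rewrite -hl' !horner2_dir => /addrI/(mulIf uy).
have k0 : (1 != 0 :> R) || (k != 0) by rewrite oner_neq0.
apply: contraNneq (d2 1 k k0 gk) => E; rewrite lk in h2.
by apply/eqP/oppr_inj; rewrite (addr0_eq h2) -mulrN (addr0_eq g2) -E vyE; ring.
Qed.

Lemma partial_xE p a b : partial_x (fun x y => p.[x, y]) a b = (dX p).[a, b].
Proof.
have d := is_derive_horner2 p (is_derive_cst b a 1).
by rewrite /partial_x derive1E [LHS]derive_val horner2_dir mul1r mul0r addr0.
Qed.

Lemma partial_yE p a b : partial_y (fun x y => p.[x, y]) a b = (dY p).[a, b].
Proof. by rewrite /partial_y -derivE horner_dY. Qed.

Lemma simple_contact_tangent u v a b : simple_contact u v a b ->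
  common_tangent_line (fun x y => u.[x, y]) (fun x y => v.[x, y]) a b.
Proof.
case=> u0 v0 gr [r r0 [d1 _]].
have xE : (dX v).[a, b] = r * (dX u).[a, b].
  by have := d1 1 0; rewrite !horner2_dir !mul0r !mul1r !addr0.
have yE : (dY v).[a, b] = r * (dY u).[a, b].
  by have := d1 0 1; rewrite !horner2_dir !mul0r !mul1r !add0r.
eexists; split; split; rewrite ?partial_xE ?partial_yE //.
  by rewrite xE yE !mulf_eq0 (negPf r0).
apply/seteqP; split=> z /= E.
  by rewrite xE yE -!mulrA -mulrDr E mulr0.
by apply: (mulfI r0); rewrite mulr0 -E xE yE; ring.
Qed.

End ContactReal.

Theorem theoremB (R : realType) (n : int) :
  (forall a b : R,
     let F x y : R := (extXY R (f_ n)).[x, y] in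
     let T x y : R := (extXY R (tau_ n)).[x, y] in
     F a b = 0 -> T a b = 0 ->
     [/\ common_tangent_line F T a b,
         partial_y F a b != 0 -> partial_y T a b != 0 ->
           implicit_second_derivatives_differ F T a b
       & partial_x F a b != 0 -> partial_x T a b != 0 ->
           implicit_second_derivatives_differ
             (fun y x => F x y) (fun y x => T x y) b a])
  /\
  (forall a b : R[i],
     (extXY R[i] (f_ n)).[a, b] = 0 -> (extXY R[i] (tau_ n)).[a, b] = 0 ->
     zero_multiplicity (extXY R[i] (f_ n)) (extXY R[i] (tau_ n)) a b 2).
Proof.
split=> [a b F T F0 T0|a b F0 T0].
  have con := torsion_contact F0 T0; split; first exact: simple_contact_tangent.
    rewrite [partial_y F a b]partial_yE [partial_y T a b]partial_yE.
    exact: simple_contact_second_derivatives.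
  rewrite [partial_x F a b]partial_xE [partial_x T a b]partial_xE => Fx Tx.
  have swapE p : (fun y x => p.[x, y]) = (fun y x : R => (swapXY p).[y, x]).
    by apply/funext => y; apply/funext => x; rewrite horner2_swapXY.
  rewrite /F /T !swapE; apply: simple_contact_second_derivatives.
  - exact: simple_contact_swap.
  - by rewrite /dY swapXYK horner2_swapXY.
  - by rewrite /dY swapXYK horner2_swapXY.
exact/simple_contact_multiplicity/torsion_contact.
Qed.
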